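(* Let $\mathbb{M}_n$ be the algebra of complex $n\times n$ matrices and let $\Delta$ be an elementary operator of length $2$ on $\mathbb{M}_n$. Then one of the following conditions holds. (1) There exists a nonzero multiplication operator $\mathrm{M}$ on $\mathbb{M}_n$ such that $\mathrm{M}\Delta=0$. (2) $\Delta$ is a sum of two invertible multiplication operators and is invertible.
   Context: A multiplication operator on $\mathbb{M}_n$ is a map $T\mapsto ATB$ with $A,B\in\mathbb{M}_n$. An elementary operator on $\mathbb{M}_n$ is a finite sum of multiplication operators; its length is the minimum number of multiplication operators needed to represent it. Products are compositions, and invertibility means invertibility as a linear map on $\mathbb{M}_n$. *)

(* Defs.v *)
From HB Require Import structures.
From mathcomp Require Import all_boot all_order all_algebra.
From mathcomp Require Import reals.
From mathcomp Require Import complex.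

Set Implicit Arguments.
Unset Strict Implicit.
Unset Printing Implicit Defensive.

Import Order.TTheory GRing.Theory Num.Theory.
Local Open Scope ring_scope.

Section Operators.
Variables (K : fieldType) (n : nat).
Implicit Types (A B : 'M[K]_n) (M N D : 'End('M[K]_n)).

Definition mulop A B : 'End('M[K]_n) := linfun (mulmxr B \o mulmx A).

Lemma mulopE A B T : mulop A B T = A *m T *m B.
Proof. by rewrite lfunE. Qed.

Definition is_mulop M : Prop := exists A B, M = mulop A B.

(* The multiplication operators need not be distinct or nonzero, and the empty
   sum (k = 0) represents the zero operator. *)
Definition sum_of_mulops D (k : nat) : Prop :=
  exists2 M : 'I_k -> 'End('M[K]_n),
    forall i, is_mulop (M i) & D = \sum_(i < k) M i.

Definition elementary D : Prop := exists k, sum_of_mulops D k.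

Definition has_length D (k : nat) : Prop :=
  sum_of_mulops D k /\ forall m, sum_of_mulops D m -> (k <= m)%N.

Definition invertible_op D : Prop :=
  exists N, (N \o D)%VF = \1%VF /\ (D \o N)%VF = \1%VF.

End Operators.

(* Main.v *)
Require Import Defs.
From mathcomp Require Import all_boot all_order all_algebra.
From mathcomp Require Import reals.
From mathcomp Require Import complex.
From mathcomp Require Import boolp.

Set Implicit Arguments.
Unset Strict Implicit.
Unset Printing Implicit Defensive.

Import Order.TTheory GRing.Theory Num.Theory.
Local Open Scope ring_scope.
Local Open Scope complex_scope.

(** Write [Delta] as [T |-> A1 T B1 + A2 T B2]. If [A1] and [B2] are both
    singular, nonzero matrices [C] and [D] with [C A1 = 0] and [B2 D = 0] give
    a nonzero multiplication operator [T |-> C T D] that kills [Delta] from the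
    left ([mulop_annihilator]). The representation can be sheared,
      [A1 (x) B1 + A2 (x) B2 = (A1 + x A2) (x) B1 + A2 (x) (B2 - x B1)],
    so if no such operator exists, then in every representation, and for every
    [x], at least one of [A1 + x A2] and [B2 - x B1] is invertible; likewise,
    exchanging the two terms, at least one of [A2] and [B1].

    Two consequences follow from the existence of eigenvalues over an
    algebraically closed field. If [A2], say, is invertible, then some
    [A1 + x A2] is singular, so the matching [B2 - x B1] is invertible: neither
    pencil is identically singular, and two generic shears make all four
    coefficients invertible ([unit_representation]). Moreover, a nonzero
    kernel element [X] of [Delta] would satisfy the Sylvester equation
    [S X = X U] with [S = A2^-1 A1] and [U = - B2 B1^-1]. Then [S] and [U] share
    an eigenvalue [u] ([sylvester_eigenvalue]), and [A1 - u A2] and [B2 + u B1]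
    are both singular, which was excluded. So [Delta] is injective, hence
    invertible. *)

(** * Eigenvalues and matrix pencils *)

Lemma unitmx_subr_scalar (K : fieldType) (n : nat) (A : 'M[K]_n) (a : K) :
  (A - a%:M \in unitmx) = ~~ root (char_poly A) a.
Proof.
by rewrite -eigenvalue_root_char /eigenvalue /eigenspace negbK kermx_eq0
  row_free_unit.
Qed.

Lemma unitmxN (K : fieldType) (n : nat) (A : 'M[K]_n) :
  (- A \in unitmx) = (A \in unitmx).
Proof. by rewrite -scaleN1r unitmxZ // unitrN1. Qed.

Lemma unitmx_pencil (K : fieldType) (n : nat) (P Q : 'M[K]_n) (x : K) :
  Q \in unitmx ->
  (P + x *: Q \in unitmx) = ~~ root (char_poly (P *m invmx Q)) (- x).
Proof.
move=> Qu; rewrite -unitmx_subr_scalar.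
have -> : P + x *: Q = (P *m invmx Q - (- x)%:M) *m Q.
  by rewrite mulmxBl mulmxKV // mul_scalar_mx scaleNr opprK.
by rewrite unitmx_mul Qu andbT.
Qed.

Lemma singular_pencil_value (K : closedFieldType) (n : nat)
    (P Q : 'M[K]_n.+1) :
  Q \in unitmx -> exists x, P + x *: Q \notin unitmx.
Proof.
move=> Qu.
have /closed_rootP[a ra] : size (char_poly (P *m invmx Q)) != 1.
  by rewrite size_char_poly.
by exists (- a); rewrite unitmx_pencil // opprK ra.
Qed.

Lemma unit_pencil_value (K : closedFieldType) (n : nat) (P Q : 'M[K]_n) :
  Q \in unitmx -> exists x, P + x *: Q \in unitmx.
Proof.
move=> Qu.
have /closed_nonrootP[a ra] : char_poly (P *m invmx Q) != 0.
  by rewrite monic_neq0 // char_poly_monic.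
by exists (- a); rewrite unitmx_pencil // opprK.
Qed.

Definition pencil_det (K : fieldType) (n : nat) (P Q : 'M[K]_n) : {poly K} :=
  \det (map_mx polyC P + 'X *: map_mx polyC Q).

Lemma root_pencil_det (K : fieldType) (n : nat) (P Q : 'M[K]_n) (x : K) :
  root (pencil_det P Q) x = (P + x *: Q \notin unitmx).
Proof.
rewrite /root /pencil_det -horner_evalE -det_map_mx unitmxE unitfE negbK.
congr (\det _ == 0); apply/matrixP=> i j.
by rewrite !mxE /= horner_evalE hornerD hornerM hornerX !hornerC.
Qed.

(** The bad values of each pencil are the roots of a nonzero polynomial, and
    the product of two nonzero polynomials has a nonroot. *)
Lemma common_unit_pencil_value (K : closedFieldType) (n : nat)
    (P Q P' Q' : 'M[K]_n) :
  (exists x, P + x *: Q \in unitmx) -> (exists x, P' + x *: Q' \in unitmx) ->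
  exists x, (P + x *: Q \in unitmx) && (P' + x *: Q' \in unitmx).
Proof.
have det_neq0 (M N : 'M[K]_n) :
    (exists x, M + x *: N \in unitmx) -> pencil_det M N != 0.
  case=> x Mx; apply: contraTneq Mx => p0.
  by rewrite -root_pencil_det p0 root0.
move=> /det_neq0 p_neq0 /det_neq0 q_neq0.
have /closed_nonrootP[x] : pencil_det P Q * pencil_det P' Q' != 0.
  by rewrite mulf_neq0.
by rewrite rootM !root_pencil_det negb_or !negbK => Px; exists x.
Qed.

(** If [p] is the characteristic polynomial of [U], then
    [p(S) X = X p(U) = 0], so [p(S)] is singular; it is the product of the
    [S - u] over the eigenvalues [u] of [U], so one of these factors is
    singular. *)
Lemma sylvester_eigenvalue (K : closedFieldType) (m n : nat) (S : 'M[K]_m.+1)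
    (U : 'M[K]_n.+1) (X : 'M[K]_(m.+1, n.+1)) :
  S *m X = X *m U -> X != 0 ->
  exists u, (S - u%:M \notin unitmx) && (U - u%:M \notin unitmx).
Proof.
move=> SX X_neq0.
have hornerSX (p : {poly K}) : horner_mx S p *m X = X *m horner_mx U p.
  elim/poly_ind: p => [|p c IHp]; first by rewrite !rmorph0 mul0mx mulmx0.
  rewrite !rmorphD !rmorphM /= !horner_mx_X !horner_mx_C mulmxDl mulmxDr.
  by rewrite -!mulmxE -mulmxA SX mulmxA IHp -mulmxA mul_scalar_mx mul_mx_scalar.
have pS_sing : horner_mx S (char_poly U) \notin unitmx.
  apply: contra X_neq0 => pSu.
  by rewrite -(mulKmx pSu X) hornerSX Cayley_Hamilton !mulmx0.
have [r def_p] := closed_field_poly_normal (char_poly U).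
rewrite (monicP (char_poly_monic U)) scale1r in def_p.
have [/allP r_unit | /allPn[u ur Su]] :=
    boolP (all (fun u => S - u%:M \in unitmx) r); last first.
  by exists u; rewrite Su unitmx_subr_scalar negbK def_p root_prod_XsubC.
case/negP: pS_sing; rewrite def_p rmorph_prod big_seq.
apply: (big_ind (fun M : 'M[K]_m.+1 => M \in unitmx)) => [|M N Mu Nu|u ur] /=.
- exact: unitmx1.
- by rewrite -mulmxE unitmx_mul Mu.
by rewrite rmorphB /= horner_mx_X horner_mx_C r_unit.
Qed.

(** * Multiplication operators *)

Definition left_annihilated (K : fieldType) (n : nat)
    (D : 'End('M[K]_n)) : Prop :=
  exists M : 'End('M[K]_n), [/\ is_mulop M, M != 0 & (M \o D)%VF = 0].

Lemma mulop_neq0 (K : fieldType) (n : nat) (A B : 'M[K]_n) :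
  A != 0 -> B != 0 -> mulop A B != 0.
Proof.
have entry_neq0 (M : 'M[K]_n) : M != 0 -> exists i j, M i j != 0.
  move=> M_neq0.
  have [/existsP[i /existsP[j Mij]] | M0] :=
      boolP [exists i, exists j, M i j != 0]; first by exists i, j.
  case/eqP: M_neq0; apply/matrixP=> i j; rewrite mxE; apply/eqP.
  by apply: contraNT M0 => Mij; apply/existsP; exists i; apply/existsP; exists j.
move=> /entry_neq0[i [k Aik]] /entry_neq0[l [j Blj]].
apply: contra_neq (mulf_neq0 Aik Blj) => AB0.
have /matrixP/(_ i j) : mulop A B (delta_mx k l) = 0 by rewrite AB0 lfunE.
rewrite mulopE -(mul_delta_mx (ord0 : 'I_1)) mulmxA -colE -mulmxA -rowE !mxE big_ord1.
by rewrite !mxE.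
Qed.

Lemma mulop_annihilator (K : fieldType) (n : nat) (A1 B1 A2 B2 : 'M[K]_n) :
  A1 \notin unitmx -> B2 \notin unitmx ->
  left_annihilated (mulop A1 B1 + mulop A2 B2).
Proof.
rewrite -(row_free_unit A1) -kermx_eq0 => C_neq0.
rewrite -unitmx_tr -row_free_unit -kermx_eq0 => D_neq0.
set C := kermx A1 in C_neq0; set D := (kermx B2^T)^T.
have CA1 : C *m A1 = 0 by apply: mulmx_ker.
have B2D : B2 *m D = 0.
  by apply: trmx_inj; rewrite trmx_mul trmxK mulmx_ker trmx0.
exists (mulop C D); split; first by exists C, D.
  by apply: mulop_neq0 => //; rewrite -trmx_eq0 trmxK.
apply/lfunP=> T; rewrite comp_lfunE add_lfunE !mulopE zero_lfunE.
by rewrite mulmxDr !mulmxA CA1 !mul0mx add0r -mulmxA B2D mulmx0.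
Qed.

Lemma mulop_shear (K : fieldType) (n : nat) (x : K) (A1 B1 A2 B2 : 'M[K]_n) :
  mulop A1 B1 + mulop A2 B2 =
  mulop (A1 + x *: A2) B1 + mulop A2 (B2 - x *: B1).
Proof.
apply/lfunP=> T; rewrite !add_lfunE !mulopE !mulmxDl mulmxBr.
by rewrite -!scalemxAl -scalemxAr -addrA; congr (_ + _); rewrite addrC subrK.
Qed.

Lemma invertible_op_inj (K : fieldType) (n : nat) (D : 'End('M[K]_n)) :
  (forall X, D X = 0 -> X = 0) -> invertible_op D.
Proof.
move=> D_inj.
have kerD : lker D == 0%VS.
  apply/lker0P=> X Y DXY; apply/eqP; rewrite -subr_eq0; apply/eqP/D_inj.
  by rewrite linearB /= DXY subrr.
by exists (D^-1)%VF; rewrite lker0_compVf // lker0_compfV.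
Qed.

Lemma invertible_mulop (K : fieldType) (n : nat) (A B : 'M[K]_n) :
  A \in unitmx -> B \in unitmx -> invertible_op (mulop A B).
Proof.
move=> Au Bu; apply: invertible_op_inj => X; rewrite mulopE => AXB0.
by rewrite -(mulKmx Au X) -(mulmxK Bu (A *m X)) AXB0 mul0mx mulmx0.
Qed.

(** * Operators that no multiplication operator annihilates *)

Section NotAnnihilated.
Variables (K : closedFieldType) (n : nat) (D : 'End('M[K]_n.+1)).
Hypothesis D_free : ~ left_annihilated D.
Implicit Types A B : 'M[K]_n.+1.

Lemma cross_unit A1 B1 A2 B2 :
  D = mulop A1 B1 + mulop A2 B2 -> A1 \notin unitmx -> B2 \in unitmx.
Proof.
move=> defD A1s; apply: contra_notT D_free => B2s.
by rewrite defD; apply: mulop_annihilator.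
Qed.

Lemma regular_pencil A1 B1 A2 B2 :
  D = mulop A1 B1 + mulop A2 B2 -> A2 \in unitmx ->
  exists x, B2 + x *: (- B1) \in unitmx.
Proof.
move=> defD /(singular_pencil_value A1)[x Ax]; exists x.
by rewrite scalerN; apply: cross_unit Ax; rewrite defD; apply: mulop_shear.
Qed.

(** A first shear makes [A1] and [B2] invertible. A second one, in the
    opposite direction, turns [A2] and [B1] into generic members of pencils
    whose leading coefficients are the invertible [A1] and [B2], and leaves
    [A1] and [B2] alone. *)
Lemma unit_representation A1 B1 A2 B2 :
  D = mulop A1 B1 + mulop A2 B2 ->
  exists A1' B1' A2' B2', [/\ D = mulop A1' B1' + mulop A2' B2',
    A1' \in unitmx, B1' \in unitmx, A2' \in unitmx & B2' \in unitmx].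
Proof.
move=> defD; have defD' := defD; rewrite addrC in defD'.
have [x /andP[A1u B2u]] :
    exists x, (A1 + x *: A2 \in unitmx) && (B2 + x *: (- B1) \in unitmx).
  apply: common_unit_pencil_value.
    have [/unit_pencil_value // | A2s] := boolP (A2 \in unitmx).
    have B1u := cross_unit defD' A2s.
    (* The roles of the A's and the B's are interchanged here: - B1 is the
       invertible leading coefficient, and some B2 - x B1 is singular. *)
    have [|x Bx] := @singular_pencil_value _ _ B2 (- B1).
      by rewrite unitmxN.
    exists x; apply: contraNT Bx => Ax; rewrite scalerN.
    by apply: cross_unit Ax; rewrite defD; apply: mulop_shear.
  have [/(regular_pencil defD) // | A2s] := boolP (A2 \in unitmx).
  by apply: unit_pencil_value; rewrite unitmxN (cross_unit defD').
set A := A1 + x *: A2 in A1u; set B := B2 + x *: (- B1) in B2u.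
have defD2 : D = mulop A2 B + mulop A B1.
  by rewrite defD (mulop_shear x) addrC /B scalerN.
have [y /andP[A2u B1u]] :
    exists y, (A2 + y *: A \in unitmx) && (B1 + y *: (- B) \in unitmx).
  by apply: common_unit_pencil_value; apply: unit_pencil_value;
    rewrite ?unitmxN.
exists (A2 + y *: A), B, A, (B1 - y *: B); split=> //.
  by rewrite defD2; apply: mulop_shear.
by rewrite -scalerN.
Qed.

Lemma not_annihilated_invertible A1 B1 A2 B2 :
  D = mulop A1 B1 + mulop A2 B2 -> A2 \in unitmx -> B1 \in unitmx ->
  invertible_op D.
Proof.
move=> defD A2u B1u; apply: invertible_op_inj => X.
rewrite defD add_lfunE !mulopE => /eqP; rewrite addr_eq0 => /eqP AXB.
apply/eqP; apply: contraT => X_neq0.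
pose S := invmx A2 *m A1; pose U := - (B2 *m invmx B1).
have SX : S *m X = X *m U.
  rewrite -(mulmxK B1u (S *m X)) /S -!mulmxA (mulmxA A1) (mulmxA (A1 *m X)) AXB.
  by rewrite mulNmx -!mulmxA mulmxN mulKmx // mulmxN.
have [u /andP[Su Uu]] := sylvester_eigenvalue SX X_neq0.
have defA : A1 + (- u) *: A2 = A2 *m (S - u%:M).
  by rewrite mulmxBr mulKVmx // mul_mx_scalar scaleNr.
have defB : B2 - (- u) *: B1 = - (U - u%:M) *m B1.
  by rewrite opprB opprK mulmxDl mulmxKV // mul_scalar_mx scaleNr opprK addrC.
have As : A1 + (- u) *: A2 \notin unitmx by rewrite defA unitmx_mul A2u.
have : B2 - (- u) *: B1 \in unitmx.
  by apply: cross_unit As; rewrite defD; apply: mulop_shear.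
by rewrite defB unitmx_mul unitmxN (negPf Uu).
Qed.

End NotAnnihilated.

Theorem corollary9 (R : realType) (n : nat) (Delta : 'End('M[R[i]]_n)) :
  elementary Delta -> has_length Delta 2 ->
  (exists M : 'End('M[R[i]]_n),
     [/\ is_mulop M, M != 0 & (M \o Delta)%VF = 0])
  \/
  ((exists M1 M2 : 'End('M[R[i]]_n),
      [/\ is_mulop M1, invertible_op M1, is_mulop M2, invertible_op M2
        & Delta = M1 + M2])
   /\ invertible_op Delta).
Proof.
move=> _ [[M M_mulop defDelta] Delta_min].
have [] := EM (left_annihilated Delta); first by left.
case: n => [|n] in Delta M M_mulop defDelta Delta_min *.
  (* The algebra of empty matrices is zero, so the empty sum represents Delta. *)
  move=> _; suff /Delta_min : sum_of_mulops Delta 0 by [].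
  exists (fun _ => 0); first by case.
  by rewrite big_ord0; apply/lfunP=> T; rewrite !flatmx0.
move=> D_free; right.
have [A1 [B1 defM1]] := M_mulop 0; have [A2 [B2 defM2]] := M_mulop 1.
have defD : Delta = mulop A1 B1 + mulop A2 B2.
  rewrite defDelta big_ord_recl big_ord1 -defM1 -defM2.
  by congr (_ + M _); apply/val_inj.
have [A1' [B1' [A2' [B2' [defD' A1u B1u A2u B2u]]]]] :=
  unit_representation D_free defD.
split; last exact: not_annihilated_invertible D_free _ _ _ _ defD' A2u B1u.
exists (mulop A1' B1'), (mulop A2' B2').
by split=> //; [exists A1', B1' | exact: invertible_mulop
  | exists A2', B2' | exact: invertible_mulop].
Qed.
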